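(* The variety of distributive lattices (in the language $\wedge,\vee$, without constants for bounds) is universally complete.
   Context: A clause is a pair $\Sigma\Rightarrow\Delta$ of finite (possibly empty) sets of identities; it is valid in a class of algebras if in each member every assignment of the variables making all identities in $\Sigma$ true makes at least one identity in $\Delta$ true. A clause $\Sigma\Rightarrow\Delta$ is admissible in a quasivariety $\mathcal{Q}$ if for every substitution $\sigma$ (endomorphism of the algebra of formulas over countably infinitely many variables) such that $\sigma(\varphi')\approx\sigma(\psi')$ is valid in $\mathcal{Q}$ for all $\varphi'\approx\psi'\in\Sigma$, the identity $\sigma(\varphi)\approx\sigma(\psi)$ is valid in $\mathcal{Q}$ for some $\varphi\approx\psi\in\Delta$. $\mathcal{Q}$ is universally complete if each clause is admissible in $\mathcal{Q}$ exactly when it is valid in $\mathcal{Q}$. All algebras are non-empty. *)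

(* Defs.v *)
From Stdlib Require List.
From mathcomp Require Import all_boot.

Set Implicit Arguments.
Unset Strict Implicit.
Unset Printing Implicit Defensive.

Record signature := Signature {
  symbol : Type;
  arity : symbol -> nat }.

Record algebra (S : signature) := Algebra {
  carrier :> Type;
  carrier_nonempty : inhabited carrier;
  op : forall f : symbol S, ('I_(arity f) -> carrier) -> carrier }.

Definition homomorphism (S : signature) (A B : algebra S) (h : A -> B) : Prop :=
  forall (f : symbol S) (a : 'I_(arity f) -> A),
    h (op a) = op (fun i => h (a i)).

Inductive term (S : signature) : Type :=
| Var of nat
| App (f : symbol S) of 'I_(arity f) -> term S.

Arguments Var {S} _.

Definition term_algebra (S : signature) : algebra S :=
  @Algebra S (term S) (inhabits (Var 0)) (@App S).

Fixpoint eval (S : signature) (A : algebra S) (v : nat -> A) (t : term S) : A :=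
  match t with
  | Var n => v n
  | App f a => op (fun i => eval v (a i))
  end.

Definition substitution (S : signature) (sigma : term S -> term S) : Prop :=
  @homomorphism S (term_algebra S) (term_algebra S) sigma.

Definition identity (S : signature) : Type := (term S * term S)%type.

Definition subst_identity (S : signature) (sigma : term S -> term S)
  (e : identity S) : identity S := (sigma e.1, sigma e.2).

Definition holds (S : signature) (A : algebra S) (v : nat -> A)
  (e : identity S) : Prop := eval v e.1 = eval v e.2.

(* Finite sets of identities are represented by lists; only membership is
   ever used, so order and repetition are irrelevant. *)
Record clause (S : signature) := Clause {
  premises : seq (identity S);
  conclusions : seq (identity S) }.

Definition algebra_class (S : signature) : Type := algebra S -> Prop.

Definition valid_identity (S : signature) (K : algebra_class S)
  (e : identity S) : Prop :=
  forall A : algebra S, K A -> forall v : nat -> A, holds v e.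

Definition valid (S : signature) (K : algebra_class S) (c : clause S) : Prop :=
  forall A : algebra S, K A -> forall v : nat -> A,
    (forall e, List.In e (premises c) -> holds v e) ->
    exists2 e, List.In e (conclusions c) & holds v e.

Definition admissible (S : signature) (K : algebra_class S)
  (c : clause S) : Prop :=
  forall sigma : term S -> term S, substitution sigma ->
    (forall e, List.In e (premises c) ->
       valid_identity K (subst_identity sigma e)) ->
    exists2 e, List.In e (conclusions c) &
      valid_identity K (subst_identity sigma e).

Definition universally_complete (S : signature) (K : algebra_class S) : Prop :=
  forall c : clause S, admissible K c <-> valid K c.

Definition variety (S : signature) (E : seq (identity S)) : algebra_class S :=
  fun A => forall e, List.In e E -> forall v : nat -> A, holds v e.

Inductive lattice_symbol := Meet | Join.

Definition lattice_signature : signature :=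
  Signature (fun _ : lattice_symbol => 2).

Definition lattice_app (f : lattice_symbol) (s t : term lattice_signature) :
    term lattice_signature :=
  @App lattice_signature f (fun i : 'I_2 => if i == ord0 then s else t).

Definition distributive_lattice_identities : seq (identity lattice_signature) :=
  let x := Var 0 in let y := Var 1 in let z := Var 2 in
  let meet := lattice_app Meet in let join := lattice_app Join in
  [:: (meet x y, meet y x);
      (join x y, join y x);
      (meet x (meet y z), meet (meet x y) z);
      (join x (join y z), join (join x y) z);
      (meet x (join x y), x);
      (join x (meet x y), x);
      (meet x (join y z), join (meet x y) (meet x z))].

Definition distributive_lattices : algebra_class lattice_signature :=
  variety distributive_lattice_identities.

(* Main.v *)
Require Import Defs.
From mathcomp Require Import all_boot.
From Stdlib Require Import Classical FunctionalExtensionality.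

Set Implicit Arguments.
Unset Strict Implicit.
Unset Printing Implicit Defensive.

(* An identity is valid in all distributive lattices iff it holds in the
   two-element lattice 2, and a quasi-identity refuted in a distributive lattice
   is refuted in 2: a pair a, b with a not below b can be moved so as to decide
   any given element x, since either a /\ x is not below b, or a is not below
   b \/ x.  Hence the functions from valuations to 2 form a distributive lattice
   in which validity can be tested, so valid clauses are admissible.
   Conversely, if a clause fails in some distributive lattice, each of its
   conclusions is refuted by a 2-valued model of the premises.  If the models
   found so far are among the valuations k |-> (g k)(u), for lattice terms g k
   evaluated at varying u, a further model w is added with two fresh variables
   y, z, replacing g k by (g k /\ y) \/ z if w k is true, and by
   (g k /\ y) \/ (z /\ y) otherwise: the values (1,0), (0,1), (0,0), (1,1) of
   (y, z) give the old valuation, w, and the two constant valuations, which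
   satisfy every lattice identity.  The substitution k |-> g k then makes all
   premises valid and no conclusion. *)

(** * Terms, substitutions and powers over an arbitrary signature *)

Lemma eval_substitution (S : signature) (sigma : term S -> term S)
    (A : algebra S) (v : nat -> A) (t : term S) : substitution sigma ->
  eval v (sigma t) = eval (fun n => eval v (sigma (Var n))) t.
Proof.
move=> hom; elim: t => [n|f a IH] //=.
rewrite (hom f a) /=; congr op.
by apply: functional_extensionality => i; apply: IH.
Qed.

Lemma substitution_eval (S : signature) (g : nat -> term S) :
  substitution (@eval S (term_algebra S) g).
Proof. by []. Qed.

Fixpoint var_bound (S : signature) (t : term S) : nat :=
  match t with
  | Var n => n.+1
  | App f a => \max_i var_bound (a i)
  end.

Lemma eq_eval_bound (S : signature) (A : algebra S) (u v : nat -> A)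
    (n : nat) (t : term S) :
  var_bound t <= n -> (forall i, i < n -> u i = v i) -> eval u t = eval v t.
Proof.
move=> tn uv; elim: t tn => [i|f a IH] /=; first exact: uv.
move=> /bigmax_leqP tn; congr op.
by apply: functional_extensionality => i; apply/IH/tn.
Qed.

Definition power (S : signature) (A : algebra S) (I : Type) : algebra S :=
  @Algebra S (I -> A)
    (let: inhabits x := carrier_nonempty A in inhabits (fun _ => x))
    (fun f a i => op (fun j => a j i)).

Lemma eval_power (S : signature) (A : algebra S) (I : Type)
    (v : nat -> power A I) (t : term S) (i : I) :
  eval v t i = eval (fun n => v n i) t.
Proof.
elim: t => [n|f a IH] //=; congr op.
exact: functional_extensionality.
Qed.

Lemma holds_power (S : signature) (A : algebra S) (I : Type)
    (v : nat -> power A I) (e : identity S) :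
  holds v e <-> forall i, holds (fun n => v n i) e.
Proof.
split=> [ve i|ve]; first by rewrite /holds -!eval_power ve.
by apply: functional_extensionality => i; rewrite !eval_power; apply: ve.
Qed.

Lemma variety_power (S : signature) (E : seq (identity S)) (A : algebra S)
    (I : Type) : variety E A -> variety E (power A I).
Proof. by move=> EA e eE v; apply/holds_power => i; apply: EA. Qed.

(** * The two-element lattice *)

Notation lterm := (term lattice_signature).

Definition two : algebra lattice_signature :=
  @Algebra lattice_signature bool (inhabits true)
    (fun f a => match f return ('I_2 -> bool) -> bool with
                | Meet => fun a => a ord0 && a ord_max
                | Join => fun a => a ord0 || a ord_max
                end a).

Lemma distributive_two : distributive_lattices two.
Proof.
move=> e eE v; rewrite /holds.
case: eE => [<-|[<-|[<-|[<-|[<-|[<-|[<-|[]]]]]]]] /=;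
  by case: (v 0); case: (v 1); case: (v 2).
Qed.

(** Both operations are idempotent, so each one-element subset is a subalgebra. *)
Lemma eval_two_const (b : bool) (t : lterm) : @eval _ two (fun=> b) t = b.
Proof.
by elim: t => [n|[] a IH] //=; rewrite !IH ?andbb ?orbb.
Qed.

Lemma eval_lattice_app (A : algebra lattice_signature) (v : nat -> A)
    (f : lattice_symbol) (s t : lterm) :
  eval v (lattice_app f s t) =
  @op _ A f (fun i : 'I_2 => if i == ord0 then eval v s else eval v t).
Proof.
by rewrite /=; congr op; apply: functional_extensionality => i; case: ifP.
Qed.

(** * Order and separation in a distributive lattice *)

Section DistributiveLattice.

Variable A : algebra lattice_signature.
Hypothesis A_distributive : distributive_lattices A.

Definition lop (f : lattice_symbol) (x y : A) : A :=
  @op lattice_signature A f (fun i : 'I_2 => if i == ord0 then x else y).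

Local Notation meet := (lop Meet).
Local Notation join := (lop Join).

Definition le (x y : A) : Prop := meet x y = x.

Lemma op_lop (f : lattice_symbol) (a : 'I_2 -> A) :
  @op lattice_signature A f a = lop f (a ord0) (a ord_max).
Proof.
congr op; apply: functional_extensionality => i.
by case: eqP => [->|ni] //; congr a; apply/val_inj; case: i ni => [[|[|]]] // p [];
  apply/val_inj.
Qed.

Lemma distributive_axioms (x y z : A) :
  [/\ meet x y = meet y x /\ join x y = join y x,
      meet x (meet y z) = meet (meet x y) z,
      meet x (join x y) = x, join x (meet x y) = x
    & meet x (join y z) = join (meet x y) (meet x z)].
Proof.
(* The default value [z] of [nth] is what [Var 2] receives. *)
pose v n := nth z [:: x; y] n.
have ax k : k < 7 ->
    holds v (nth (Var 0, Var 0) distributive_lattice_identities k).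
  move=> k7; apply: A_distributive.
  by case: k k7 => [|[|[|[|[|[|[|]]]]]]] //= _; auto 8.
split; [split; [have := ax 0 isT | have := ax 1 isT] | have := ax 2 isT
  | have := ax 4 isT | have := ax 5 isT | have := ax 6 isT];
  by rewrite /holds !eval_lattice_app.
Qed.

Lemma meetC x y : meet x y = meet y x.
Proof. by case: (distributive_axioms x y x) => -[]. Qed.

Lemma joinC x y : join x y = join y x.
Proof. by case: (distributive_axioms x y x) => -[]. Qed.

Lemma meetA x y z : meet x (meet y z) = meet (meet x y) z.
Proof. by case: (distributive_axioms x y z). Qed.

Lemma meet_joinK x y : meet x (join x y) = x.
Proof. by case: (distributive_axioms x y x). Qed.

Lemma join_meetK x y : join x (meet x y) = x.
Proof. by case: (distributive_axioms x y x). Qed.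

Lemma meet_joinr x y z : meet x (join y z) = join (meet x y) (meet x z).
Proof. by case: (distributive_axioms x y z). Qed.

Lemma le_refl x : le x x.
Proof. by rewrite /le -{2}(join_meetK x x) meet_joinK. Qed.

Lemma le_trans x y z : le x y -> le y z -> le x z.
Proof. by rewrite /le => xy yz; rewrite -xy -meetA yz. Qed.

Lemma le_anti x y : le x y -> le y x -> x = y.
Proof. by rewrite /le => xy yx; rewrite -xy meetC. Qed.

Lemma le_meetr x y : le (meet x y) y.
Proof. by rewrite /le -meetA [meet y y]le_refl. Qed.

Lemma le_meetl x y : le (meet x y) x.
Proof. by rewrite meetC; apply: le_meetr. Qed.

Lemma le_joinl x y : le x (join x y).
Proof. exact: meet_joinK. Qed.

Lemma le_joinr x y : le y (join x y).
Proof. by rewrite joinC; apply: le_joinl. Qed.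

Lemma meet_glb x y z : le z x -> le z y -> le z (meet x y).
Proof. by rewrite /le meetA => -> ->. Qed.

Lemma join_lub x y z : le x z -> le y z -> le (join x y) z.
Proof.
by rewrite /le => xz yz; rewrite meetC meet_joinr ![meet z _]meetC xz yz.
Qed.

(** By distributivity [a] is the join of [meet a b] and [meet a x], both below [b]. *)
Lemma le_cut x a b : le (meet a x) b -> le a (join b x) -> le a b.
Proof.
move=> axb abx; rewrite -abx meet_joinr.
by apply: join_lub => //; apply: le_meetr.
Qed.

(** A finite substitute for a prime filter: true stands for the filter above [a], false for the
    ideal below [b]. *)
Definition decides (a b : A) (v : nat -> A) (w : nat -> bool) (n : nat) : Prop :=
  forall i, i < n -> if w i then le a (v i) else le (v i) b.

Lemma decide_variables (v : nat -> A) (n : nat) (a b : A) : ~ le a b ->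
  exists w a' b',
    [/\ le a' a, le b b', ~ le a' b' & decides a' b' v w n].
Proof.
move=> ab; elim: n => [|n [w [c [d [ca bd cd dec]]]]].
  by exists xpredT, a, b; split=> //; apply: le_refl.
(* Earlier decisions survive, since [c] only moves down and [d] only moves up. *)
pose w' x i := if i == n then x else w i.
have [cnd|cnd] := classic (le (meet c (v n)) d).
  exists (w' false), c, (join d (v n)); split=> //.
  - by apply: le_trans bd _; apply: le_joinl.
  - by move/(le_cut cnd).
  move=> i; rewrite ltnS leq_eqVlt /w'; case: eqP => [-> _|_ /dec].
    exact: le_joinr.
  by case: ifP => // _ vd; apply: le_trans vd _; apply: le_joinl.
exists (w' true), (meet c (v n)), d; split=> //.
  by apply: le_trans ca; apply: le_meetl.
move=> i; rewrite ltnS leq_eqVlt /w'; case: eqP => [-> _|_ /dec].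
  exact: le_meetr.
by case: ifP => // _; apply: le_trans; apply: le_meetl.
Qed.

(** Filters and ideals are closed under both operations in the way that [two] computes, so decisions
    on variables propagate to terms. *)
Lemma decides_eval a b v w n (t : lterm) : decides a b v w n ->
  var_bound t <= n ->
  if @eval _ two w t then le a (eval v t) else le (eval v t) b.
Proof.
move=> dec; elim: t => [i|f c IH] /=; first exact: dec.
move=> /bigmax_leqP bc.
have {IH} IH i := IH i (bc i isT).
rewrite op_lop; case: f c IH {bc} => c IH /=.
  have := IH ord0; case: ifP => /= _ H0.
    have := IH ord_max; case: ifP => /= _ H1; first exact: meet_glb.
    by apply: le_trans H1; apply: le_meetr.
  by apply: le_trans H0; apply: le_meetl.
have := IH ord0; case: ifP => /= _ H0.
  by apply: le_trans H0 _; apply: le_joinl.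
have := IH ord_max; case: ifP => /= _ H1; last exact: join_lub.
by apply: le_trans H1 _; apply: le_joinr.
Qed.

Lemma refutation_two (v : nat -> A) (P : seq (identity lattice_signature))
    (e : identity lattice_signature) :
  (forall p, List.In p P -> holds v p) -> ~ holds v e ->
  exists2 w : nat -> two,
    (forall p, List.In p P -> holds w p) & ~ holds w e.
Proof.
case: e => s t vP.
(* By antisymmetry one of the two inequalities fails. *)
wlog nle : s t / ~ le (eval v s) (eval v t) => [sym|_].
  have [st|st] := classic (le (eval v s) (eval v t)) => ne; last exact: sym.
  have ts : ~ le (eval v t) (eval v s) by move=> ts; apply/ne/le_anti.
  case: (sym t s ts) => [/esym //|w wP we].
  by exists w => // /esym.
pose bd (p : identity lattice_signature) := maxn (var_bound p.1) (var_bound p.2).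
pose n := foldr (fun p => maxn (bd p)) (bd (s, t)) P.
have bst : bd (s, t) <= n.
  by rewrite /n; elim: (P) => //= p Q IH; rewrite leq_max IH orbT.
have bP p : List.In p P -> bd p <= n.
  rewrite /n; elim: (P) => //= q Q IH [->|/IH pQ]; rewrite leq_max ?leqnn //.
  by rewrite pQ orbT.
have [w [a [b [a_s t_b ab dec]]]] := decide_variables v n nle.
(* A premise true in [A] cannot have one side above [a] and the other below [b], so [w] gives both
   sides the same value. *)
have sep x y : le a (eval v x) -> le (eval v y) b -> eval v x <> eval v y.
  by move=> ax yb xy; apply/ab/(le_trans ax); rewrite xy.
have aw x : bd x <= n -> @eval _ two w x.1 = @eval _ two w x.2 ->
    ~ (le a (eval v x.1) /\ le (eval v x.2) b).
  rewrite geq_max => /andP[/(decides_eval dec) H1 /(decides_eval dec) H2].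
  move=> E [ax xb]; apply: ab; move: H1 H2; rewrite E; case: ifP => _ H1 H2.
    exact: le_trans H2 xb.
  exact: le_trans ax H1.
exists w; last by move=> E; apply: (aw (s, t)).
move=> p pP; have := bP p pP; rewrite geq_max => /andP[].
move=> /(decides_eval dec) H1 /(decides_eval dec) H2.
have E := vP p pP; rewrite /holds /=; move: H1 H2.
case: (@eval _ two w p.1); case: (@eval _ two w p.2) => // H1 H2.
  by case: (sep _ _ H1 H2).
by case: (sep _ _ H2 H1).
Qed.

End DistributiveLattice.

(** * Validity against admissibility *)

Lemma valid_identity_two (e : identity lattice_signature) :
  valid_identity distributive_lattices e <-> forall w : nat -> two, holds w e.
Proof.
split=> [ve w|two_e A dA v]; first exact/ve/distributive_two.
apply: NNPP => /(@refutation_two A dA v [::] e) [//|w _]; apply.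
exact: two_e.
Qed.

Lemma valid_admissible (c : clause lattice_signature) :
  valid distributive_lattices c -> admissible distributive_lattices c.
Proof.
move=> vc sigma hom prem.
pose F := power two (nat -> two).
(* Under [v] a term denotes the term function of its image by [sigma]. *)
pose v k : F := fun u => eval u (sigma (Var k)).
have vF e : holds v e <->
    valid_identity distributive_lattices (subst_identity sigma e).
  rewrite holds_power valid_identity_two.
  by split=> ve u; have := ve u; rewrite /holds /= !(eval_substitution u _ hom).
have dF : distributive_lattices F by apply/variety_power/distributive_two.
have [e|e eD /vF] := vc F dF v; last by exists e.
by move=> /prem /vF.
Qed.

(** [P] will be satisfaction of the premises; the bound [n] supplies the fresh variables for the
    next step of the induction on [D]. *)
Lemma separating_terms (P : (nat -> two) -> Prop)
    (D : seq (identity lattice_signature)) :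
  (forall b : bool, P (fun=> b)) ->
  (forall e, List.In e D -> exists2 w, P w & ~ holds w e) ->
  exists g : nat -> lterm, exists n : nat,
    [/\ forall k, var_bound (g k) <= n,
        forall u, P (fun k => @eval _ two u (g k))
      & forall e, List.In e D ->
          exists u, ~ holds (fun k => @eval _ two u (g k)) e].
Proof.
move=> Pconst; elim: D => [|d D IH] sep.
  by exists (fun=> Var 0), 1; split=> // u; apply: (Pconst (u 0)).
have [e eD|g [n [gn Pg sepg]]] := IH; first by apply: sep; right.
have [w Pw wd] := sep d (or_introl erefl).
pose y : lterm := Var n; pose z : lterm := Var n.+1.
pose h k := lattice_app Join (lattice_app Meet (g k) y)
              (lattice_app Meet z (if w k then z else y)).
have hE (u : nat -> two) k : @eval _ two u (h k) =
    (@eval _ two u (g k) && u n) || (u n.+1 && (if w k then u n.+1 else u n)).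
  by rewrite /h /=; case: (w k).
(* Here [y] gets [b] and [z] its negation: true recovers the valuation given by [g], false produces
   [w] whatever [u] is. *)
pose ext (u : nat -> two) (b : bool) : nat -> two :=
  fun i => if i < n then u i else if i == n then b else ~~ b.
have ext_g u b k : @eval _ two (ext u b) (g k) = @eval _ two u (g k).
  by apply: eq_eval_bound (gn k) _ => i; rewrite /ext => ->.
have ext_n u b : (ext u b n = b) * (ext u b n.+1 = ~~ b).
  by rewrite /ext ltnn eqxx ltnNge leqnSn /= eqn_leq ltnn.
exists h, n.+2; split.
- move=> k; rewrite /h /=.
  apply/bigmax_leqP => i _; case: ifP => _ /=; apply/bigmax_leqP => j _.
    by case: ifP => _ //=; apply: leq_trans (gn k) _; rewrite leqW.
  by case: ifP => _ //=; case: (w k).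
- move=> u; case un: (u n); case um: (u n.+1).
  + suff -> : (fun k => @eval _ two u (h k)) = (fun=> true) by apply: (Pconst true).
    by apply: functional_extensionality => k; rewrite hE un um if_same orbT.
  + suff -> : (fun k => @eval _ two u (h k)) = (fun k => @eval _ two u (g k)) by [].
    by apply: functional_extensionality => k; rewrite hE un um andbT orbF.
  + suff -> : (fun k => @eval _ two u (h k)) = w by [].
    by apply: functional_extensionality => k; rewrite hE un um andbF; case: (w k).
  suff -> : (fun k => @eval _ two u (h k)) = (fun=> false) by apply: (Pconst false).
  by apply: functional_extensionality => k; rewrite hE un um andbF.
move=> e [<-|/sepg [u ue]].
  exists (ext (fun=> false) false).
  suff -> : (fun k => @eval _ two (ext (fun=> false) false) (h k)) = w by [].
  by apply: functional_extensionality => k; rewrite hE !ext_n andbF; case: (w k).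
exists (ext u true).
suff -> : (fun k => @eval _ two (ext u true) (h k)) =
          (fun k => @eval _ two u (g k)) by [].
by apply: functional_extensionality => k; rewrite hE !ext_n ext_g andbT orbF.
Qed.

Lemma admissible_valid (c : clause lattice_signature) :
  admissible distributive_lattices c -> valid distributive_lattices c.
Proof.
move=> adm A dA v prem; apply: NNPP => nconc.
pose P (w : nat -> two) := forall e, List.In e (premises c) -> holds w e.
have Pconst (b : bool) : P (fun=> b).
  by move=> e _; rewrite /holds !eval_two_const.
have [e eD|g [n [_ Pg sep]]] := @separating_terms P (conclusions c) Pconst.
  by apply: (refutation_two dA prem) => ve; apply: nconc; exists e.
have hom := substitution_eval g.
have [e eP|e eD /valid_identity_two ve] := adm _ hom.
  apply/valid_identity_two => u; have := Pg u e eP.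
  by rewrite /holds /= !(eval_substitution u _ hom).
have [u] := sep e eD; apply; have := ve u.
by rewrite /holds /= !(eval_substitution u _ hom).
Qed.

Theorem theorem16 : universally_complete distributive_lattices.
Proof. by move=> c; split; [apply: admissible_valid | apply: valid_admissible]. Qed.
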